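(* There is an $\mathcal{O}(n)$ time algorithm that, given an idempotent map $\iota\in I(n)$ stored in an array whose elements may be modified in the range $[-n,n]$, computes in-place of $\iota$ the corresponding idempotent permutation $\pi\in IP(n)$ (with its characteristic function defined implicitly) using $\log n$ bits of additional space.
   Context: $[n]=\{1,\ldots,n\}$. $I(n)$ is the set of idempotent maps $\iota:[n]\to[n]$ ($\iota(\iota(x))=\iota(x)$ for all $x$); $I(n,k)$ is the subset with image of cardinality $k$. For $\iota\in I(n,k)$ with fixed points $a_1<\cdots<a_k$, put $[a_i]_\iota=\{x\in[n]:\iota(x)=a_i\}$. An idempotent permutation of degree $k$ ($1\le k\le n$) is a permutation $\pi$ of $[n]$ together with a distinguished set of indices $A=\{a_1<\cdots<a_k\}\subseteq[n]$ such that the values $c_i=\pi(a_i)$ satisfy $1=c_1<c_2<\cdots<c_k$. The values $c_i$ are called the fixed elements of $\pi$ (this does not mean $\pi(c_i)=c_i$), the others idle. Put $c_{k+1}=n+1$ and $[a_i]_\pi=\{x\in[n]:c_i\le\pi(x)<c_{i+1}\}$. $IP(n,k)$ denotes the set of these, $IP(n)=\bigcup_k IP(n,k)$; idempotent permutations with the same $A$ and the same sets $[a_i]_\pi$ are regarded as equivalent. The idempotent permutation $\pi\in IP(n,k)$ corresponds to $\iota\in I(n,k)$ if $A$ is the set of fixed points of $\iota$ and $[a_i]_\pi=[a_i]_\iota$ for all $i$ (so that $c_{i+1}-c_i=|[a_i]_\iota|$). The characteristic function $\varphi(x)=1$ if $x\in A$ and $0$ otherwise is ''defined implicitly'' when $\pi$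 is stored with fixed elements negated: the entry at $x$ is $-\pi(x)$ if $x\in A$ and $\pi(x)$ otherwise. ''In-place'' means the array $D[1\ldots n]$ initially holds $\iota$ and finally holds this signed version of $\pi$. Computation is on a unit-cost random access machine; ''$\log n$ bits'' means that amount of memory besides the array. *)

(* Defs.v *)
From mathcomp Require Import all_boot all_order all_algebra all_fingroup.

Set Implicit Arguments.
Unset Strict Implicit.
Unset Printing Implicit Defensive.

(* The element x of [n] = {1, ..., n} is represented by the
   ordinal x - 1 : 'I_n; [label] maps it back to {1, ..., n}. *)

Definition label n (x : 'I_n) : nat := x.+1.

(** Idempotent maps and idempotent permutations *)

Definition fixed_points n (iota : {ffun 'I_n -> 'I_n}) : {set 'I_n} :=
  [set x | iota x == x].

(* The sequence c_1, ..., c_k of the values of p on A = {a_1 < ... < a_k};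
   [enum] lists a set of ordinals in increasing order. *)
Definition fixed_elements n (p : {perm 'I_n}) (A : {set 'I_n}) : seq nat :=
  [seq label (p a) | a <- enum A].

(* The degree k is #|ip_dist|; it is positive because c_1 = 1 exists
   (the head of the empty sequence is 0 here). *)
Record idem_perm n := IdemPerm {
  ip_perm :> {perm 'I_n};
  ip_dist : {set 'I_n};
  ip_head : head 0 (fixed_elements ip_perm ip_dist) = 1;
  ip_sorted : sorted ltn (fixed_elements ip_perm ip_dist)
}.

(* i counts from 0; the default value of [nth] gives c_{k+1} = n + 1. *)
Definition fixed_element n (P : idem_perm n) (i : nat) : nat :=
  nth n.+1 (fixed_elements P (ip_dist P)) i.

Definition perm_class n (P : idem_perm n) (i : nat) : {set 'I_n} :=
  [set x | fixed_element P i <= label (P x) < fixed_element P i.+1].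

Definition map_class n (iota : {ffun 'I_n -> 'I_n}) (a : 'I_n) : {set 'I_n} :=
  [set x | iota x == a].

Definition corresponds n (iota : {ffun 'I_n -> 'I_n}) (P : idem_perm n) :=
  ip_dist P = fixed_points iota /\
  forall i : 'I_#|ip_dist P|,
    perm_class P i = map_class iota (enum_val i).

(** Array contents *)

Definition map_array n (iota : {ffun 'I_n -> 'I_n}) : {ffun 'I_n -> int} :=
  [ffun x => Posz (label (iota x))].

Definition signed_perm_array n (P : idem_perm n) : {ffun 'I_n -> int} :=
  [ffun x => if x \in ip_dist P then (- Posz (label (P x)))%R
             else Posz (label (P x))].

(** A unit-cost random access machine with r registers and the array
    D[1..n].  Register i holds a natural number of at most [w i] bits and every
    cell of D holds an integer in [-n, n].  Every access outside D and every
    store that does not fit blocks the machine.  The length n is a read-only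
    input.  The registers are the only storage besides D. *)

Inductive operand (r : nat) :=
| Imm of int                (* an integer constant *)
| Len                       (* n *)
| Idx of 'I_r & int         (* Idx i d: the content of register i, plus d *)
| Cell of 'I_r & int        (* Cell i d: D[reg i + d] *)
| Ind of 'I_r & int.        (* Ind i d: D[D[reg i + d]] *)

Inductive dest (r : nat) :=
| ToReg of 'I_r
| ToCell of 'I_r & int
| ToInd of 'I_r & int.

Inductive arith := Plus | Minus.

Inductive comparison := Le | Eq.

Inductive instr (r : nat) :=
| Op of dest r & operand r & arith & operand r
| Jump of operand r & comparison & operand r & nat.

Definition program r := seq (instr r).

Record config (n r : nat) := Config {
  pc : nat;
  regs : {ffun 'I_r -> nat};
  arr : {ffun 'I_n -> int}
}.

Section Semantics.
Variables (n r : nat) (w : 'I_r -> nat).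
Implicit Types (s : config n r) (z : int) (x : 'I_n) (i : 'I_r).

Definition position z : option 'I_n :=
  if z is Posz m.+1 then insub m else None.

Definition idx s i z : int := (Posz (regs s i) + z)%R.

Definition read s z : option int := omap (arr s) (position z).

Definition eval s (a : operand r) : option int :=
  match a with
  | Imm z => Some z
  | Len => Some (Posz n)
  | Idx i d => Some (idx s i d)
  | Cell i d => read s (idx s i d)
  | Ind i d => obind (read s) (read s (idx s i d))
  end.

Definition arith_fun (o : arith) (u v : int) : int :=
  match o with Plus => (u + v)%R | Minus => (u - v)%R end.

Definition compare_fun (c : comparison) (u v : int) : bool :=
  match c with Le => (u <= v)%R | Eq => u == v end.

Definition store_reg s i (v : int) : option (config n r) :=
  if v is Posz m then
    if m < 2 ^ w i then
      Some (Config (pc s).+1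
                   [ffun j => if j == i then m else regs s j] (arr s))
    else None
  else None.

Definition store_cell s z (v : int) : option (config n r) :=
  if (- Posz n <= v <= Posz n)%R then
    omap (fun x => Config (pc s).+1 (regs s)
                          [ffun y => if y == x then v else arr s y])
         (position z)
  else None.

Definition store s (l : dest r) (v : int) : option (config n r) :=
  match l with
  | ToReg i => store_reg s i v
  | ToCell i d => store_cell s (idx s i d) v
  | ToInd i d => obind (fun z => store_cell s z v) (read s (idx s i d))
  end.

Definition exec s (c : instr r) : option (config n r) :=
  match c with
  | Op l a o b =>
      obind (fun u => obind (fun v => store s l (arith_fun o u v)) (eval s b))
            (eval s a)
  | Jump a t b l =>
      obind (fun u => omap (fun v =>
          Config (if compare_fun t u v then l else (pc s).+1) (regs s) (arr s))
          (eval s b))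
        (eval s a)
  end.

Definition halted (prog : program r) s : bool := size prog <= pc s.

Definition step (prog : program r) s : option (config n r) :=
  obind (exec s) (onth prog (pc s)).

Definition start (D : {ffun 'I_n -> int}) : config n r :=
  Config 0 [ffun => 0] D.

(* [run prog D t] is the configuration after exactly t steps from the initial
   array D, or None if the machine halted earlier or blocked. *)
Definition run (prog : program r) (D : {ffun 'I_n -> int}) (t : nat) :
    option (config n r) :=
  iter t (obind (step prog)) (Some (start D)).

End Semantics.

(* The program halts on D after t steps with array D'. *)
Definition computes_in n r (w : 'I_r -> nat) (prog : program r)
    (D D' : {ffun 'I_n -> int}) (t : nat) :=
  exists s : config n r,
    [/\ run w prog D t = Some s, halted prog s & arr s = D'].

(* Main.v *)
Require Import Defs.
From mathcomp Require Import all_boot all_order all_algebra all_fingroup.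
From mathcomp Require Import zify.

Set Implicit Arguments.
Unset Strict Implicit.
Unset Printing Implicit Defensive.

(** The single register walks over the array; all other storage is found in
    the cells.  Fixed points are marked by negative entries, and a pass over
    the idle elements turns D[a] into minus the size of the class of a.  The
    sizes must become partial sums e_a = c_a + |[a]| - 1, which requires an
    accumulator besides the index, and D[1] is made to serve as such.  If 1
    is fixed, sum from the right: n minus the sizes to the right of a is e_a,
    so that D[1] itself ends up with its own value.  If 1 is idle with image
    a, remember a by storing 0, an otherwise unused value, in D[a]; the
    forgotten size of a is not needed, since a prefix pass from the left
    settles the fixed points below a, and a suffix pass from the right
    settles those above a and reaches a with the accumulator equal to e_a.
    The register then holds a, so that D[1] can be restored.  Finally each
    idle x takes the value e_a stored at a = iota x, which is decremented;
    the counters at the fixed points end at c_a. *)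

(** * Counting in the classes of an idempotent map *)

Section Counting.
Variables (n : nat) (iota : {ffun 'I_n -> 'I_n}).
Hypothesis iotaK : forall x, iota (iota x) = iota x.

(** At a fixed point [a], [below a] is c_a - 1 and [below a.+1] is e_a, the greatest value in the
    class of [a]. *)
Definition below (k : nat) : nat := \sum_(y : 'I_n) (iota y < k).

Definition class_size (x : 'I_n) : nat := \sum_(y : 'I_n) (iota y == x).

(** How far the counter at [x] has moved once a pass from the left has handled the indices below
    [k]. *)
Definition idle_before (k : nat) (x : 'I_n) : nat :=
  \sum_(y : 'I_n) [&& y < k, y != x & iota y == x].

(** The value [n] lies above every index, which puts the fixed point first in its class; among idle
    elements the larger index comes first. *)
Definition height (x : 'I_n) : nat := if iota x == x then n else x.

(* The algorithm hands out decreasing values to the idle elements of a class as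
   it meets them, and leaves the least value to the fixed point. *)
Definition precedes (y x : 'I_n) : bool :=
  (iota y < iota x) || (iota y == iota x) && (height x < height y).

Definition position_of (x : 'I_n) : nat := \sum_(y : 'I_n) precedes y x.

Lemma sum_pred1 (x : 'I_n) : \sum_(y : 'I_n) (y == x) = 1.
Proof. by rewrite -big_mkcond big_pred1_eq. Qed.

Lemma sum_bool_le (b : 'I_n -> bool) : \sum_(y : 'I_n) b y <= n.
Proof.
rewrite -[leqRHS]card_ord -sum1_card leq_sum // => y _; exact: leq_b1.
Qed.

Lemma below_le k : below k <= n. Proof. exact: sum_bool_le. Qed.

Lemma below0 : below 0 = 0.
Proof. by rewrite /below big1. Qed.

Lemma belown k : n <= k -> below k = n.
Proof.
move=> le_nk; rewrite -[RHS]card_ord -sum1_card; apply: eq_bigr => y _.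
by rewrite (leq_trans (ltn_ord _) le_nk).
Qed.

Lemma below_mono : {homo below : k l / k <= l}.
Proof.
move=> k l le_kl; apply: leq_sum => y _.
by case: ltnP => // lt_yk; rewrite (leq_trans lt_yk).
Qed.

Lemma belowS (x : 'I_n) : below x.+1 = below x + class_size x.
Proof.
rewrite -big_split; apply: eq_bigr => y _ /=.
by rewrite ltnS leq_eqVlt -val_eqE /=; case: ltngtP.
Qed.

Lemma class_size_idle (x : 'I_n) : iota x != x -> class_size x = 0.
Proof.
move=> idle_x; rewrite /class_size big1 // => y _.
by case: eqP => // def_x; rewrite -def_x iotaK eqxx in idle_x.
Qed.

Lemma idle_before0 x : idle_before 0 x = 0.
Proof. by rewrite /idle_before big1. Qed.

Lemma idle_before_le k x : idle_before k x <= n.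
Proof. exact: sum_bool_le. Qed.

Lemma idle_beforeS (k x : 'I_n) :
  idle_before k.+1 x = idle_before k x + ((k != x) && (iota k == x)).
Proof.
have -> : ((k != x) && (iota k == x) : nat) =
    \sum_(y : 'I_n | y == k) ((y != x) && (iota y == x)).
  by rewrite big_pred1_eq.
rewrite [X in _ + X]big_mkcond -big_split; apply: eq_bigr => y _ /=.
have [->|neq_yk] := eqVneq y k; first by rewrite ltnSn ltnn.
by rewrite ltnS leq_eqVlt val_eqE (negPf neq_yk) addn0.
Qed.

Lemma idle_beforen (x : 'I_n) :
  iota x = x -> (idle_before n x).+1 = class_size x.
Proof.
move=> fix_x; rewrite -add1n -(sum_pred1 x) -big_split.
apply: eq_bigr => y _ /=; rewrite ltn_ord /=.
by have [->|] := eqVneq y x; rewrite ?fix_x ?eqxx.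
Qed.

Lemma idle_before_lt k (x : 'I_n) :
  iota x = x -> idle_before k x < class_size x.
Proof.
move=> fix_x; rewrite -idle_beforen // ltnS leq_sum // => y _.
by rewrite ltn_ord; case: (y < k).
Qed.

Lemma class_size_le x : class_size x <= n. Proof. exact: sum_bool_le. Qed.

(** * Ranks in the order [precedes] *)

Lemma precedes_trans : transitive precedes.
Proof. by move=> y x z; rewrite /precedes -!val_eqE /=; lia. Qed.

Lemma precedes_irr : irreflexive precedes.
Proof. by move=> y; rewrite /precedes -!val_eqE /=; lia. Qed.

(** Only fixed points have height [n], and a class has only one of them. *)
Lemma height_inj (x y : 'I_n) :
  iota x = iota y -> height x = height y -> x = y.
Proof.
rewrite /height => eq_xy; have := ltn_ord x; have := ltn_ord y.
have [<-|_] := eqVneq (iota x) x; have [<-|_] := eqVneq (iota y) y => //.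
- by move=> lt_yn _ def_n; rewrite -def_n ltnn in lt_yn.
- by move=> _ lt_xn def_n; rewrite def_n ltnn in lt_xn.
- by move=> _ _ /val_inj.
Qed.

Lemma precedes_total (x y : 'I_n) : x != y -> precedes x y || precedes y x.
Proof.
apply: contraR; rewrite /precedes => nprec.
have eq_xy : iota x = iota y by apply: val_inj => /=; lia.
by apply/eqP/height_inj => //; move: nprec; rewrite eq_xy eqxx /=; lia.
Qed.

Lemma position_of_lt (x y : 'I_n) :
  precedes x y -> position_of x < position_of y.
Proof.
move=> prec_xy; rewrite -add1n -(sum_pred1 x) -big_split leq_sum // => u _ /=.
have [->|_] := eqVneq u x; first by rewrite precedes_irr prec_xy.
by case prec_ux: (precedes u x); rewrite // (precedes_trans prec_ux).
Qed.

Lemma position_of_inj (x y : 'I_n) : position_of x = position_of y -> x = y.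
Proof.
move=> eq_xy; apply/eqP; apply: contraT => /precedes_total.
by case/orP => /position_of_lt; rewrite eq_xy ltnn.
Qed.

(** An element of a class up to that of [x] precedes [x], is [x], or lies lower in the class of [x];
    injectivity of heights leaves no other case. *)
Lemma position_of_split (x : 'I_n) :
  below (iota x).+1 = (position_of x).+1 +
    \sum_(y : 'I_n) ((iota y == iota x) && (height y < height x)).
Proof.
rewrite -[(position_of x).+1]addn1 -(sum_pred1 x) -!big_split;
  apply: eq_bigr => y _ /=.
have [->|neq_yx] := eqVneq y x.
  by rewrite precedes_irr leqnn ltnn andbF.
have: (iota y == iota x) ==> (height y != height x).
  by apply/implyP => /eqP eq_yx; apply: contra neq_yx => /eqP/height_inj->.
by rewrite /precedes -val_eqE /=; lia.
Qed.

Lemma position_of_ub (x : 'I_n) : position_of x < below (iota x).+1.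
Proof. by rewrite position_of_split leq_addr. Qed.

Lemma position_of_lb (x : 'I_n) : below (iota x) <= position_of x.
Proof. by apply: leq_sum => y _; rewrite /precedes; case: ltnP. Qed.

Lemma position_of_ltn (x : 'I_n) : position_of x < n.
Proof. exact: leq_trans (position_of_ub x) (below_le _). Qed.

Lemma position_of_fixed (x : 'I_n) : iota x = x -> position_of x = below x.
Proof.
move=> fix_x; apply: eq_bigr => y _; rewrite /precedes /height fix_x eqxx.
have -> : (n < (if iota y == y then n else y)) = false.
  by have := ltn_ord y; case: ifP => _; lia.
by rewrite andbF orbF.
Qed.

(** After [x] in its class come exactly the idle elements of smaller index, already served when a
    pass from the left reaches [x]. Hence e_a minus their number, for a = [iota x], is the value due
    to [x]. *)
Lemma position_of_idle (x : 'I_n) : iota x != x ->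
  (position_of x).+1 + idle_before x (iota x) = below (iota x).+1.
Proof.
move=> idle_x; rewrite position_of_split; congr (_ + _).
apply: eq_bigr => y _; rewrite /height (negPf idle_x).
have [->|_] := eqVneq (iota y) (iota x); last by rewrite !andbF.
rewrite andbT /= [_ == y]eq_sym; case: eqVneq => _; last by rewrite andbT.
by rewrite andbF ltnNge ltnW.
Qed.

(** * The corresponding idempotent permutation *)

Definition idem_perm_of : {perm 'I_n} :=
  perm (fun x y (e : Ordinal (position_of_ltn x) = Ordinal (position_of_ltn y))
    =>
          position_of_inj (congr1 val e)).

Lemma idem_perm_ofE x : idem_perm_of x = position_of x :> nat.
Proof. by rewrite permE. Qed.

Lemma fixed_elementsE :
  fixed_elements idem_perm_of (fixed_points iota) =
  [seq (below a).+1 | a : 'I_n <- enum (fixed_points iota)].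
Proof.
apply/eq_in_map => a; rewrite mem_enum inE => /eqP fix_a.
by rewrite /label idem_perm_ofE position_of_fixed.
Qed.

Lemma sorted_enum_ord (A : {set 'I_n}) : sorted (relpre val ltn) (enum A).
Proof.
rewrite -sorted_map; apply: (subseq_sorted ltn_trans _ (iota_ltn_sorted 0 n)).
by rewrite -val_enum_ord map_subseq // enumT; exact: filter_subseq.
Qed.

Lemma relpre_val_trans : transitive (relpre (@nat_of_ord n) ltn).
Proof. by move=> y x z; apply: ltn_trans. Qed.

Lemma enum_val_lt (A : {set 'I_n}) (i j : 'I_#|A|) :
  i < j -> enum_val i < enum_val j.
Proof.
move=> lt_ij; rewrite (enum_val_nth (enum_val i)) [X in _ < nat_of_ord
  X](enum_val_nth (enum_val i)).
apply: (sorted_ltn_nth relpre_val_trans _ (sorted_enum_ord A)) => //;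
  by rewrite inE -cardE.
Qed.

Lemma below_lt (a : 'I_n) k : iota a = a -> a < k -> below a < below k.
Proof.
move=> fix_a lt_ak; apply: leq_trans (below_mono lt_ak).
by rewrite belowS -idle_beforen // -addSnnS leq_addr.
Qed.

Lemma idem_perm_of_sorted :
  sorted ltn (fixed_elements idem_perm_of (fixed_points iota)).
Proof.
rewrite fixed_elementsE sorted_map.
apply: (@sub_in_sorted _ [in fixed_points iota]) (sorted_enum_ord _).
  by move=> a b; rewrite !inE => /eqP fix_a _ /= lt_ab; rewrite ltnS below_lt.
by apply/allP => a; rewrite mem_enum.
Qed.

(** Each [iota y] is a fixed point, hence not below the least one, [a]. *)
Lemma below_first (s : seq 'I_n) a :
  enum (fixed_points iota) = a :: s -> below a = 0.
Proof.
move=> def_A; rewrite /below big1 // => y _.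
have: iota y \in a :: s by rewrite -def_A mem_enum inE iotaK.
have := sorted_enum_ord (fixed_points iota); rewrite def_A /=.
move/(order_path_min relpre_val_trans).
rewrite inE => /allP lt_a /predU1P[->|/lt_a /=]; first by rewrite ltnn.
by move/ltnW; rewrite leqNgt => /negPf->.
Qed.

Lemma idem_perm_of_head : 0 < n ->
  head 0 (fixed_elements idem_perm_of (fixed_points iota)) = 1.
Proof.
move=> n_gt0; rewrite fixed_elementsE.
case def_A: (enum _) => [|a s] /=; last by rewrite (below_first def_A).
have: iota (Ordinal n_gt0) \in enum (fixed_points iota).
  by rewrite mem_enum inE iotaK.
by rewrite def_A.
Qed.

Lemma fixed_elementE (P : idem_perm n) (i : 'I_#|fixed_points iota|) :
    ip_perm P = idem_perm_of -> ip_dist P = fixed_points iota ->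
  fixed_element P i = (below (enum_val i)).+1.
Proof.
move=> defP defA; rewrite /fixed_element defP defA fixed_elementsE.
by rewrite (nth_map (enum_val i)) -?enum_val_nth // -cardE.
Qed.

(** The value of [x] lies in the interval of its own class, numbered [j]. These intervals are
    disjoint and increasing, so comparing [j] with [i] decides membership. *)
Lemma perm_class_enum (P : idem_perm n) (i : 'I_#|fixed_points iota|) :
    ip_perm P = idem_perm_of -> ip_dist P = fixed_points iota ->
  perm_class P i = map_class iota (enum_val i).
Proof.
move=> defP defA; have cE j := @fixed_elementE P j defP defA.
apply/setP=> x; rewrite !inE cE defP /label idem_perm_ofE ltnS.
have Ax : iota x \in fixed_points iota by rewrite inE iotaK.
have [j defx] : exists j : 'I_#|fixed_points iota|, iota x = enum_val j.
  by exists (enum_rank_in Ax (iota x)); rewrite enum_rankK_in.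
have := position_of_lb x; have := position_of_ub x; rewrite defx => ub lb.
rewrite (inj_eq enum_val_inj) -val_eqE /=;
  case: (ltngtP j i) => [lt_ji|lt_ij|eq_ji].
- have := below_mono (enum_val_lt lt_ji); lia.
- have lt_iA : i.+1 < #|fixed_points iota| by exact: leq_ltn_trans (ltn_ord j).
  rewrite -[i.+1]/(val (Ordinal lt_iA)) cE.
  have: enum_val (Ordinal lt_iA) <= enum_val j.
    move: lt_ij; rewrite leq_eqVlt => /predU1P[eq_ij|lt_ij].
      by rewrite (_ : Ordinal lt_iA = j) //; apply: val_inj.
    exact/ltnW/enum_val_lt.
  by move/below_mono; lia.
- move/val_inj: eq_ji ub lb => -> ub lb; rewrite lb /=.
  suff: below (enum_val i).+1 < fixed_element P i.+1 by apply: leq_ltn_trans.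
  (* For the last fixed point the upper end is the default n + 1 of [fixed_element]. *)
  have [le_Ai|lt_iA] := leqP #|fixed_points iota| i.+1.
    rewrite /fixed_element defA nth_default ?ltnS ?below_le //.
    by rewrite size_map -cardE.
  by rewrite -[i.+1]/(val (Ordinal lt_iA)) cE ltnS below_mono ?enum_val_lt.
Qed.

End Counting.

(** * The program *)

Definition cur : 'I_2 := ord0.
Definition zero : 'I_2 := ord_max.

(* A register of width 0 holds 0 forever: it serves to address D[1]. *)
Definition width (n : nat) (i : 'I_2) : nat :=
  if i == cur then up_log 2 n else 0.

Notation lit z := (Imm 2 z).
Notation goto l := (Jump (lit 0) Eq (lit 0) l).
(** The register keeps an index minus 1, so that its range 0, ..., n - 1 fits in [up_log 2 n] bits;
    the offset 1 recovers the index. *)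
Notation this := (Idx cur 1).
Notation here := (Cell cur 1).
Notation there := (Ind cur 1).
Notation first := (Cell zero 1).
Notation set_index := (ToReg cur).
Notation set_here := (ToCell cur 1).
Notation set_there := (ToInd cur 1).
Notation set_first := (ToCell zero 1).

(* The comments give the addresses of the jump targets. *)
Definition idem_prog : program 2 := [::
  (* 0 *) Jump here Eq this 2;
          goto 3;
          Op set_here (lit 0) Minus (lit 1);
          Jump this Eq (Len 2) 6;
          Op set_index this Plus (lit 0);
          goto 0;
  (* 6 *) Op set_index (lit 0) Plus (lit 0);
  (* 7 *) Jump here Le (lit 0) 9;
          Op set_there there Minus (lit 1);
          Jump this Eq (Len 2) 12;
          Op set_index this Plus (lit 0);
          goto 7;
  (* 12 *) Jump first Le (lit 0) 22;
          Op (ToInd zero 1) (lit 0) Plus (lit 0);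
          Op set_first (lit 0) Plus (lit 0);
          Op set_index (lit 1) Plus (lit 0);
  (* 16 *) Jump here Eq (lit 0) 22;
          Jump (lit 0) Le here 20;
          Op set_first first Minus here;
          Op set_here (lit 0) Minus first;
          Op set_index this Plus (lit 0);
          goto 16;
  (* 22 *) Op set_index (Len 2) Minus (lit 1);
          Op set_first (Len 2) Plus (lit 0);
  (* 24 *) Jump (Idx cur 0) Eq (lit 0) 34;
          Jump here Eq (lit 0) 31;
          Jump (lit 0) Le here 29;
          Op set_first first Plus here;
          Op set_here here Minus first;
          Op set_index (Idx cur 0) Minus (lit 1);
          goto 24;
  (* 31 *) Op set_here (lit 0) Minus first;
          Op set_first this Plus (lit 0);
          goto 35;
  (* 34 *) Op set_first (lit 0) Minus first;
  (* 35 *) Op set_index (lit 0) Plus (lit 0);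
  (* 36 *) Jump here Le (lit 0) 39;
          Op set_there there Plus (lit 1);
          Op set_here (lit 1) Minus there;
          Jump this Eq (Len 2) 42;
          Op set_index this Plus (lit 0);
          goto 36].

(** * Symbolic execution with a bound on the steps *)

Section Machine.
Variable m : nat.
Notation n := m.+1.
Implicit Types (p q e c : nat) (x y : 'I_n) (D : {ffun 'I_n -> int}).

Definition state p x D : config n 2 :=
  Config p [ffun j => if j == cur then val x else 0] D.

Definition update D x (v : int) : {ffun 'I_n -> int} :=
  [ffun y => if y == x then v else D y].

(** A bound instead of an exact count lets branches of different length share one statement;
    reaching [Some s'] excludes blocking on the way. *)
Definition within c (s s' : config n 2) : Prop :=
  exists2 t, t <= c &
    iter t (obind (step (width n) idem_prog)) (Some s) = Some s'.

Lemma within_refl s : within 0 s s. Proof. by exists 0. Qed.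

Lemma within_le c c' s s' : c <= c' -> within c s s' -> within c' s s'.
Proof. by move=> le_c [t le_t run_t]; exists t => //; apply: leq_trans le_c.
  Qed.

Lemma within_trans c c' s1 s2 s3 :
  within c s1 s2 -> within c' s2 s3 -> within (c + c') s1 s3.
Proof.
move=> [t le_t run_t] [t' le_t' run_t']; exists (t' + t).
  by rewrite addnC leq_add.
by rewrite iterD run_t.
Qed.

Lemma within_step c s s1 s' : step (width n) idem_prog s = Some s1 ->
  within c s1 s' -> within c.+1 s s'.
Proof. by move=> ss1 [t le_t run_t]; exists t.+1; rewrite // iterSr /= ss1. Qed.

Lemma within_op c p x D l a o b u v s1 s' :
    onth idem_prog p = Some (Op l a o b) ->
    eval (state p x D) a = Some u -> eval (state p x D) b = Some v ->
    store (width n) (state p x D) l (arith_fun o u v) = Some s1 ->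
  within c s1 s' -> within c.+1 (state p x D) s'.
Proof.
move=> def_p def_u def_v def_s1; apply: within_step.
by rewrite /step /= def_p /= def_u /= def_v.
Qed.

Lemma within_jump c p x D a t b l u v s' :
    onth idem_prog p = Some (Jump a t b l) ->
    eval (state p x D) a = Some u -> eval (state p x D) b = Some v ->
  within c (state (if compare_fun t u v then l else p.+1) x D) s' ->
  within c.+1 (state p x D) s'.
Proof.
move=> def_p def_u def_v; apply: within_step.
by rewrite /step /= def_p /= def_u /= def_v.
Qed.

Lemma within_goto c p x D l s' : onth idem_prog p = Some (goto l) ->
  within c (state l x D) s' -> within c.+1 (state p x D) s'.
Proof. by move=> def_p; apply: (within_jump def_p erefl erefl). Qed.

Lemma position_label x : @position n (label x) = Some x.
Proof. by rewrite /position /label /= insubT //= => lt_xn; congr Some;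
  apply: val_inj. Qed.

Lemma idx_cur p x D : idx (state p x D) cur 1 = label x.
Proof. by rewrite /idx ffunE eqxx -PoszD addn1. Qed.

Lemma idx_zero p x D : idx (state p x D) zero 1 = label (ord0 : 'I_n).
Proof. by rewrite /idx ffunE. Qed.

Lemma eval_lit p x D z : eval (state p x D) (lit z) = Some z.
Proof. by []. Qed.

Lemma eval_len p x D : eval (state p x D) (Len 2) = Some (Posz n).
Proof. by []. Qed.

Lemma eval_this p x D : eval (state p x D) this = Some (Posz (label x)).
Proof. by rewrite /= idx_cur. Qed.

Lemma eval_index p x D : eval (state p x D) (Idx cur 0) = Some (Posz x).
Proof. by rewrite /= /idx ffunE eqxx GRing.addr0. Qed.

Lemma eval_here p x D : eval (state p x D) here = Some (D x).
Proof. by rewrite /= idx_cur /read position_label. Qed.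

Lemma eval_there p x D (a : 'I_n) : D x = label a -> eval (state p x D) there =
  Some (D a).
Proof. by rewrite /= idx_cur /read position_label /= => ->;
  rewrite position_label. Qed.

Lemma eval_first p x D : eval (state p x D) first = Some (D ord0).
Proof. by rewrite /= idx_zero /read position_label. Qed.

Definition fits (v : int) := (- Posz n <= v <= Posz n)%R.

Lemma store_index y p x D v : v = Posz y ->
  store (width n) (state p x D) set_index v = Some (state p.+1 y D).
Proof.
move=> -> /=; rewrite (leq_trans (ltn_ord y)) ?up_logP //.
congr (Some (Config _ _ _)); apply/ffunP => j; rewrite !ffunE.
by case: eqP.
Qed.

Lemma store_cell_label p x D y v : fits v ->
  store_cell (state p x D) (label y) v = Some (state p.+1 x (update D y v)).
Proof. by move=> fit_v;
  rewrite /store_cell [(_ <= _ <= _)%R]fit_v position_label. Qed.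

Lemma store_here p x D v : fits v ->
  store (width n) (state p x D) set_here v = Some (state p.+1 x (update D x v)).
Proof. by move=> fit_v; rewrite /= idx_cur store_cell_label. Qed.

Lemma store_first p x D v : fits v ->
  store (width n) (state p x D) set_first v =
    Some (state p.+1 x (update D ord0 v)).
Proof. by move=> fit_v; rewrite /= idx_zero store_cell_label. Qed.

Lemma store_there p x D (a : 'I_n) v : D x = label a -> fits v ->
  store (width n) (state p x D) set_there v = Some (state p.+1 x (update D a
    v)).
Proof.
move=> Dx fit_v.
by rewrite /= idx_cur /read position_label /= Dx store_cell_label.
Qed.

Lemma store_there_first p x D (a : 'I_n) v : D ord0 = label a -> fits v ->
  store (width n) (state p x D) (ToInd zero 1) v =
    Some (state p.+1 x (update D a v)).
Proof.
move=> Dx fit_v.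
by rewrite /= idx_zero /read position_label /= Dx store_cell_label.
Qed.

Lemma within_next c p x D y s' :
    onth idem_prog p = Some (Op set_index this Plus (lit 0)) ->
    y = x.+1 :> nat ->
  within c (state p.+1 y D) s' -> within c.+1 (state p x D) s'.
Proof.
move=> def_p def_y; apply: (within_op def_p (eval_this _ _ _) erefl).
by apply: store_index; rewrite def_y /= /label GRing.addr0.
Qed.

(** [F k] is the array once the indices below [k] are done; the 3 extra steps per round are the exit
    test, the increment and the jump back. *)
Lemma within_loop c p q e (F : nat -> {ffun 'I_n -> int}) :
    onth idem_prog q = Some (Jump this Eq (Len 2) e) ->
    onth idem_prog q.+1 = Some (Op set_index this Plus (lit 0)) ->
    onth idem_prog q.+2 = Some (goto p) ->
    (forall x, within c (state p x (F x)) (state q x (F x.+1))) ->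
  within ((c + 3) * n) (state p ord0 (F 0)) (state e ord_max (F n)).
Proof.
move=> def_q def_q1 def_q2 body.
(* Since the index ascends, the induction is on the number [k] of indices after [x]. *)
suff loop k x : x + k = m ->
    within ((c + 3) * k.+1) (state p x (F x)) (state e ord_max (F n)).
  by have := loop m ord0 erefl.
elim: k => [|k IHk] in x *; rewrite (addn0, addnS) => def_m;
  rewrite mulnS -addnA; apply: within_trans (body x) _;
  apply: (within_jump def_q (eval_this _ _ _) erefl).
  rewrite /= /label def_m eqxx.
  have -> : x = ord_max by apply: val_inj.
  by apply: within_le (within_refl _).
rewrite /= /label; case: eqP => [[def_x]|_]; first by lia.
have lt_xn : x.+1 < n by lia.
apply: (within_next (y := Ordinal lt_xn) def_q1 erefl).
apply: (within_goto def_q2).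
by apply: IHk => /=; lia.
Qed.

End Machine.

Arguments store_index {m} y p x D v _.

(** * The passes and their loop invariants *)

Section Passes.
Variables (m : nat).
Notation n := m.+1.
Variable iota : {ffun 'I_n -> 'I_n}.
Hypothesis iotaK : forall x, iota (iota x) = iota x.
Implicit Types (k : nat) (x y : 'I_n).

Let below_class x := belowS iota x.

Definition marked k : {ffun 'I_n -> int} :=
  [ffun x => if (iota x == x) && (x < k) then (-1)%R
             else Posz (label (iota x))].

(** The mark -1 already counts the fixed point itself, so at [k = n] its entry is minus the size of
    the class. *)
Definition counted k : {ffun 'I_n -> int} :=
  [ffun x => if iota x == x then (- Posz (idle_before iota k x).+1)%R
             else Posz (label (iota x))].

(* Up to D[1], the prefix pass maintains e_x at fixed x < k, and the suffix
   pass at x < iota 1 and at x >= k. *)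
Definition prefixed k : {ffun 'I_n -> int} :=
  [ffun x => if x == ord0 then Posz (below iota k)
             else if iota x != x then Posz (label (iota x))
             else if x == iota ord0 then 0%R
             else if x < k then (- Posz (below iota x.+1))%R
             else (- Posz (class_size iota x))%R].

Definition suffixed k : {ffun 'I_n -> int} :=
  [ffun x => if x == ord0 then Posz (below iota k)
             else if iota x != x then Posz (label (iota x))
             else if x == iota ord0 then 0%R
             else if (x < iota ord0) || (k <= x)
             then (- Posz (below iota x.+1))%R
             else (- Posz (class_size iota x))%R].

(** The entry at a fixed point is minus e_x plus the number of values already handed out in its
    class. *)
Definition assigned k : {ffun 'I_n -> int} :=
  [ffun x => if iota x == x
             then (Posz (idle_before iota k x) - Posz (below iota x.+1))%R
             else if x < k then Posz (position_of iota x).+1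
             else Posz (label (iota x))].

Ltac run_jump u v := apply: within_jump; [reflexivity | apply: u | apply: v |].
Ltac run_op u v w :=
  apply: within_op; [reflexivity | apply: u | apply: v | apply: w |].

Lemma within_eq c p x (D D' : {ffun 'I_n -> int}) :
  D =1 D' -> within c (state p x D) (state p x D').
Proof. by move/ffunP->; apply: within_le (within_refl _). Qed.

Lemma ltnS_neq x y : y != x -> (y < x.+1) = (y < x).
Proof. by move=> neq_yx; rewrite ltnS leq_eqVlt val_eqE (negPf neq_yx). Qed.

Lemma mark_pass :
  within (6 * n) (state 0 ord0 (marked 0)) (state 6 ord_max (marked n)).
Proof.
apply: (@within_loop _ 3 0 3) => // x.
(* The cell of [x] still holds the image of [x], so comparing it with the index detects a fixed
   point. *)
run_jump eval_here eval_this.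
rewrite /marked ffunE ltnn andbF /= /label.
have [[/val_inj fix_x]|neq_x] := eqVneq (Posz (iota x).+1) (Posz x.+1).
  run_op eval_lit eval_lit store_here; first by rewrite /fits.
  apply: within_eq => y; rewrite !ffunE.
  have [->|neq_yx] := eqVneq y x; first by rewrite fix_x eqxx leqnn.
  by rewrite ltnS_neq.
apply: within_goto => //; apply: within_eq => y; rewrite !ffunE.
have [->|neq_yx] := eqVneq y x.
  by rewrite (negPf (_ : iota x != x)) //; apply: contraNneq neq_x => ->.
by rewrite ltnS_neq.
Qed.

Lemma count_pass :
  within (5 * n) (state 7 ord0 (counted 0)) (state 12 ord_max (counted n)).
Proof.
apply: (@within_loop _ 2 7 9) => // x.
run_jump eval_here eval_lit.
rewrite {1}ffunE; have [fix_x|idle_x] := eqVneq (iota x) x.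
  apply: within_eq => y; rewrite !ffunE idle_beforeS.
  case: (iota y == y) => //; have [//|neq_xy] /= := eqVneq x y.
    by rewrite addn0.
  by rewrite fix_x (negPf neq_xy) addn0.
have D_x k : counted k x = label (iota x) by rewrite ffunE (negPf idle_x).
(* Even with [x] counted, the idle members are fewer than the class size, so the new entry is at
   least -n. *)
have fix_ix := iotaK x; have := idle_before_lt x.+1 fix_ix.
have := class_size_le iota (iota x); rewrite idle_beforeS eqxx eq_sym idle_x.
move=> le_n lt_size; run_op eval_there eval_lit store_there => //.
  by rewrite /fits ffunE iotaK eqxx /=; lia.
apply: within_eq => y; rewrite !ffunE iotaK eqxx idle_beforeS.
have [->|neq_y] := eqVneq y (iota x).
  by rewrite iotaK !eqxx eq_sym idle_x /=; lia.
by rewrite andbF addn0.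
Qed.

(** Nothing maps to an idle [x], so the accumulator is already right for [x.+1]. A fixed [x] first
    adds its size and then copies the accumulator, negated. *)
Lemma prefix_step x : 0 < x -> x < iota ord0 ->
  within 4 (state 16 x (prefixed x)) (state 20 x (prefixed x.+1)).
Proof.
move=> x_gt0 lt_xa; have x_neq0 : x != ord0 by rewrite -val_eqE -lt0n.
have x_neqa : x != iota ord0 by rewrite -val_eqE /= ltn_eqF.
have [fix_x|idle_x] := eqVneq (iota x) x; last first.
  have D_x : prefixed x x = label (iota x).
    by rewrite ffunE (negPf x_neq0) idle_x.
  run_jump eval_here eval_lit; rewrite D_x.
  run_jump eval_lit eval_here; rewrite D_x.
  apply: within_eq => y.
  rewrite !ffunE (below_class x) (class_size_idle iotaK idle_x) addn0.
  have [->|neq_yx] := eqVneq y x; first by rewrite (negPf x_neq0) idle_x.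
  by rewrite ltnS_neq.
have D_x : prefixed x x = (- Posz (class_size iota x))%R.
  by rewrite ffunE (negPf x_neq0) fix_x eqxx (negPf x_neqa) ltnn.
have D_0 k : prefixed k ord0 = Posz (below iota k) by rewrite ffunE eqxx.
have size_gt0 : 0 < class_size iota x by apply: leq_trans (idle_before_lt 0
  fix_x).
have := below_le iota x.+1; rewrite (below_class x) => le_n.
run_jump eval_here eval_lit; rewrite D_x /=.
case: eqP => [|_]; first by lia.
run_jump eval_lit eval_here; rewrite D_x /=.
case: ifP => [|_]; first by lia.
run_op eval_first eval_here store_first; rewrite /fits /= D_x D_0; first by lia.
run_op eval_lit eval_first store_here; rewrite /fits /= !ffunE eqxx;
  first by lia.
apply: within_eq => y; rewrite !ffunE.
have [->|neq_yx] := eqVneq y x.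
  rewrite (negPf x_neq0) fix_x eqxx (negPf x_neqa) ltnSn (below_class x) /=;
    lia.
rewrite (below_class x) ltnS_neq //; case: (y == ord0) => //; lia.
Qed.

(** All cells visited before [iota ord0] are nonzero, so the stored 0 stops the loop exactly
    there. *)
Lemma prefix_pass k x : 0 < x -> x + k = iota ord0 ->
  within (6 * k.+1) (state 16 x (prefixed x))
         (state 22 (iota ord0) (prefixed (iota ord0))).
Proof.
elim: k => [|k IHk] in x *; rewrite (addn0, addnS) => x_gt0 def_a.
  have def_x : x = iota ord0 by apply: val_inj.
  have x_neq0 : x != ord0 by rewrite -val_eqE -lt0n.
  run_jump eval_here eval_lit; rewrite ffunE (negPf x_neq0) def_x iotaK !eqxx.
  exact: within_le (within_refl _).
have lt_xa : x < iota ord0 by lia.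
rewrite mulnS -[6]/(4 + 2) -addnA;
  apply: within_trans (prefix_step _ _) _ => //.
have lt_xn : x.+1 < n by apply: leq_ltn_trans (ltn_ord (iota ord0)).
apply: (within_next (y := Ordinal lt_xn)); [reflexivity|by []|].
apply: within_goto; first reflexivity.
by apply: IHk => //=; lia.
Qed.

(** At a fixed [x], subtracting the size takes the accumulator from e_x to [below x]. The size,
    still in the cell, plus the new accumulator gives back e_x, so no temporary is required. *)
Lemma suffix_step x : iota ord0 < x ->
  within 4 (state 25 x (suffixed x.+1)) (state 29 x (suffixed x)).
Proof.
move=> lt_ax; have x_gt0 : 0 < x by apply: leq_ltn_trans lt_ax.
have x_neq0 : x != ord0 by rewrite -val_eqE -lt0n.
have x_neqa : x != iota ord0 by rewrite -val_eqE /= gtn_eqF.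
have leS_neq y : y != x -> (x < y) = (x <= y).
  by move=> neq_yx; rewrite [RHS]leq_eqVlt eq_sym val_eqE (negPf neq_yx).
have [fix_x|idle_x] := eqVneq (iota x) x; last first.
  have D_x : suffixed x.+1 x = label (iota x).
    by rewrite ffunE (negPf x_neq0) idle_x.
  run_jump eval_here eval_lit; rewrite D_x.
  run_jump eval_lit eval_here; rewrite D_x.
  apply: within_eq => y.
  rewrite !ffunE (below_class x) (class_size_idle iotaK idle_x) addn0.
  have [->|neq_yx] := eqVneq y x; first by rewrite (negPf x_neq0) idle_x.
  by rewrite leS_neq.
have D_x : suffixed x.+1 x = (- Posz (class_size iota x))%R.
  rewrite ffunE (negPf x_neq0) fix_x eqxx (negPf x_neqa) ltnn orbF.
  by rewrite ltnNge ltnW.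
have D_0 k : suffixed k ord0 = Posz (below iota k) by rewrite ffunE eqxx.
have size_gt0 : 0 < class_size iota x by apply: leq_trans (idle_before_lt 0
  fix_x).
have := below_le iota x.+1; rewrite (below_class x) => le_n.
run_jump eval_here eval_lit; rewrite D_x /=.
case: eqP => [|_]; first by lia.
run_jump eval_lit eval_here; rewrite D_x /=.
case: ifP => [|_]; first by lia.
run_op eval_first eval_here store_first;
  rewrite /fits /= D_x D_0 (below_class x); first by lia.
run_op eval_here eval_first store_here;
  rewrite /fits /= ffunE (negPf x_neq0) D_x ffunE eqxx; first by lia.
apply: within_eq => y; rewrite !ffunE.
have [->|neq_yx] := eqVneq y x.
  rewrite (negPf x_neq0) fix_x eqxx (negPf x_neqa) leqnn orbT (below_class x)
    /=; lia.
rewrite leS_neq //; case: (y == ord0) => //; lia.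
Qed.

(** This covers both cases for index 1: if it is fixed, [iota ord0] is [ord0] and the index test
    ends the loop; otherwise the stored 0 does. *)
Lemma suffix_pass k x : x = iota ord0 + k :> nat ->
  within (7 * k.+1) (state 24 x (suffixed x.+1)) (state 35 (iota ord0)
    (assigned 0)).
Proof.
elim: k => [|k IHk] in x *; rewrite (addn0, addnS) => def_x; last first.
  rewrite mulnS -[7]/(1 + (4 + 2)) -!addnA.
  run_jump eval_index eval_lit; rewrite /=; case: eqP => [|_]; first by lia.
  apply: within_trans (suffix_step _) _; first by rewrite def_x ltnS leq_addr.
  have lt_xn : x.-1 < n by apply: leq_ltn_trans (leq_pred _) (ltn_ord x).
  run_op eval_index eval_lit (store_index (Ordinal lt_xn)).
    by rewrite /=; lia.
  apply: within_goto; first reflexivity.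
  have {2}-> : (x : nat) = (Ordinal lt_xn).+1 by rewrite /= def_x.
  by apply: IHk; rewrite /= def_x.
have {def_x} def_x : x = iota ord0 by apply: val_inj.
have fix_x : iota x = x by rewrite def_x iotaK.
have := below_le iota x.+1 => le_n.
run_jump eval_index eval_lit.
(* The accumulator is now e_x. If [x] is [ord0] it only changes sign in place; otherwise its
   negative goes to the cell of [x], and the register supplies the lost entry at index 1. *)
have [x_eq0|x_neq0] := eqVneq x ord0.
  rewrite x_eq0 /= -x_eq0.
  have le_1 := below_le iota 1.
  run_op eval_lit eval_first store_first; rewrite /fits /= ffunE eqxx;
    first by lia.
  rewrite fix_x; apply: within_eq => y; rewrite !ffunE idle_before0 -def_x.
  have [->|y_neq0] := eqVneq y ord0.
    by rewrite -x_eq0 fix_x eqxx x_eq0 /=; lia.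
  have y_gt0 : 0 < y by rewrite lt0n; exact: y_neq0.
  by rewrite x_eq0 (negPf y_neq0) y_gt0 orbT; case: eqP => //=; lia.
have idle_0 : iota ord0 != ord0 by rewrite -def_x.
rewrite /= eqz_nat (negPf (x_neq0 : x != 0 :> nat)).
run_jump eval_here eval_lit; rewrite ffunE (negPf x_neq0) fix_x def_x !eqxx /=.
rewrite -def_x.
run_op eval_lit eval_first store_here; rewrite /fits /= ffunE eqxx;
  first by lia.
run_op eval_this eval_lit store_first; first by rewrite /fits /= /label;
  have := ltn_ord x; lia.
apply: within_goto; first reflexivity.
apply: within_eq => y; rewrite !ffunE idle_before0 -def_x.
have [->|y_neq0] := eqVneq y ord0; first by rewrite -def_x (negPf x_neq0) /=;
  lia.
have [->|neq_yx] := eqVneq y x; first by rewrite fix_x eqxx; lia.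
by rewrite -neq_ltn neq_yx; case: eqP => //=; lia.
Qed.

Lemma assign_pass :
  within (6 * n) (state 36 ord0 (assigned 0)) (state 42 ord_max (assigned n)).
Proof.
apply: (@within_loop _ 3 36 39) => // x.
run_jump eval_here eval_lit; rewrite ffunE ltnn.
have [fix_x|idle_x] := eqVneq (iota x) x.
  have := idle_before_lt x fix_x; have := below_class x => def_b lt_b.
  (* Fewer values have been handed out than the class holds, so the entry is still negative. *)
  rewrite (_ : compare_fun _ _ _); last by rewrite /=; lia.
  apply: within_eq => y; rewrite !ffunE idle_beforeS.
  have [->|neq_yx] := eqVneq y x; first by rewrite fix_x !eqxx addn0.
  by rewrite ltnS_neq // fix_x [x == y]eq_sym (negPf neq_yx) addn0.
have D_x k : k <= x -> assigned k x = label (iota x).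
  by move=> le_kx; rewrite ffunE (negPf idle_x) ltnNge le_kx.
have D_a k : assigned k (iota x) = (Posz (idle_before iota k (iota x)) - Posz
  (below iota (iota x).+1))%R.
  by rewrite ffunE iotaK eqxx.
have := idle_before_le iota x.+1 (iota x);
  rewrite idle_beforeS eqxx eq_sym idle_x /=.
have := below_le iota (iota x).+1;
  have def_p := position_of_idle idle_x => le_b le_i.
run_op eval_there eval_lit store_there; [exact: D_x|exact: D_x| |].
  by rewrite /fits D_a /=; lia.
(* Updating the counter leaves the cell of the idle [x] intact, so the counter can be read through
   it again. *)
have D_x' v : update (assigned x) (iota x) v x = label (iota x).
  by rewrite ffunE [x == _]eq_sym (negPf idle_x) D_x.
run_op eval_lit eval_there store_here; first exact: D_x'.
  by rewrite /fits ffunE eqxx D_a /=; lia.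
apply: within_eq => y; rewrite !ffunE eqxx iotaK eqxx.
have [->|neq_yx] := eqVneq y x.
  by rewrite (negPf idle_x) ltnSn /=; lia.
have [->|neq_ya] := eqVneq y (iota x).
  by rewrite iotaK !eqxx idle_beforeS eqxx eq_sym idle_x /=; lia.
by rewrite ltnS_neq // idle_beforeS [iota x == y]eq_sym (negPf neq_ya) andbF
  addn0.
Qed.

(** * Joining the passes *)

Lemma map_array_marked : map_array iota = marked 0.
Proof. by apply/ffunP => x; rewrite !ffunE ltn0 andbF. Qed.

Lemma marked_counted : marked n = counted 0.
Proof. by apply/ffunP => x; rewrite !ffunE ltn_ord andbT idle_before0. Qed.

Lemma counted_end x : iota x = x -> counted n x = (- Posz (class_size iota
  x))%R.
Proof. by move=> fix_x; rewrite ffunE fix_x eqxx idle_beforen. Qed.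

Lemma counted_suffixed : iota ord0 = ord0 ->
  update (counted n) ord0 n = suffixed n.
Proof.
move=> fix_0; apply/ffunP => x;
  rewrite /update /suffixed !ffunE belown // fix_0.
rewrite [n <= x]leqNgt ltn_ord /=.
by have [//|_] := eqVneq x ord0; case: eqVneq => //= fix_x;
  rewrite idle_beforen.
Qed.

(** As index 1 is idle, nothing maps to it, and the accumulator [below 1] is 0. *)
Lemma counted_prefixed : iota ord0 != ord0 ->
  update (update (counted n) (iota ord0) 0) ord0 0 = prefixed 1.
Proof.
move=> idle_0; apply/ffunP => x; rewrite !ffunE.
have [_|x_neq0] := eqVneq x ord0.
  have := belowS iota (ord0 : 'I_n); rewrite (class_size_idle iotaK idle_0).
  by rewrite below0 => ->.
have x_gt0 : 0 < x by rewrite lt0n; exact: x_neq0.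
have [->|_] := eqVneq x (iota ord0); first by rewrite iotaK eqxx.
by rewrite ltnS leqNgt x_gt0; case: eqVneq => //= fix_x; rewrite idle_beforen.
Qed.

(** Cells above [iota ord0] still hold sizes; only the accumulator changes, to [below n], which is
    [n]. *)
Lemma prefixed_suffixed :
  update (prefixed (iota ord0)) ord0 n = suffixed n.
Proof.
apply/ffunP => x; rewrite !ffunE (belown _ (leqnn n)) [n <= x]leqNgt ltn_ord
  orbF.
by case: (x == ord0).
Qed.

Lemma run_passes : within (38 * n) (state 0 ord0 (map_array iota))
                                   (state 42 ord_max (assigned n)).
Proof.
rewrite map_array_marked.
(* The passes cost at most 30 n steps and the instructions between them at most 8, which is at most
   8 n. *)
apply: (@within_le _
  (6 * n + (1 + (5 * n + (4 + 6 * n + (2 + (7 * n + (1 + 6 * n))))))));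
  first by lia.
apply: within_trans mark_pass _; rewrite marked_counted.
run_op eval_lit eval_lit (store_index (ord0 : 'I_n)) => //.
apply: within_trans count_pass _.
(* Both branches reach address 22 with the array of the suffix pass up to [D[1]], which is
   overwritten with [n] next. *)
suff [x pref] : exists x, exists2 D,
    within (4 + 6 * n) (state 12 ord_max (counted n)) (state 22 x D)
    & update D ord0 n = suffixed n.
  case: pref => D run_D def_D; apply: within_trans run_D _.
  run_op eval_len eval_lit (store_index (ord_max : 'I_n)); first by rewrite /=;
    lia.
  run_op eval_len eval_lit store_first; first by rewrite /fits /=; lia.
  rewrite /arith_fun GRing.addr0 def_D.
  apply: within_trans.
    apply: within_le (suffix_pass (k := m - iota ord0) _).
      by rewrite leq_mul2l ltnS leq_subr.
    by rewrite /= subnKC // -ltnS ltn_ord.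
  run_op eval_lit eval_lit (store_index (ord0 : 'I_n)) => //.
  exact: assign_pass.
have [fix_0|idle_0] := eqVneq (iota ord0) ord0.
  exists ord_max, (counted n); last exact: counted_suffixed.
  apply: within_le (_ : within 1 _ _) => //.
  run_jump eval_first eval_lit; rewrite counted_end //.
  rewrite /= (_ : (_ <= _)%R); last by lia.
  exact: within_refl.
exists (iota ord0), (prefixed (iota ord0)); last exact: prefixed_suffixed.
have D_0 : counted n ord0 = label (iota ord0) by rewrite ffunE (negPf idle_0).
have a_gt0 : 0 < iota ord0 by rewrite lt0n; exact: idle_0.
have lt_1n : 1 < n by apply: leq_ltn_trans a_gt0 (ltn_ord _).
run_jump eval_first eval_lit; rewrite D_0 /=.
run_op eval_lit eval_lit store_there_first; [exact: D_0|by []|].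
run_op eval_lit eval_lit store_first; first by [].
run_op eval_lit eval_lit (store_index (Ordinal lt_1n)) => //.
rewrite /arith_fun GRing.addr0 (counted_prefixed idle_0).
apply: within_le (prefix_pass (k := (iota ord0).-1) _ _) => //=; last by lia.
by rewrite leq_mul2l /= prednK // ltnW.
Qed.

(** * The computed idempotent permutation *)

Definition idem_perm_for : idem_perm n :=
  IdemPerm (idem_perm_of_head iotaK (ltn0Sn m)) (idem_perm_of_sorted iota).

(** A fixed point has given away all values of its class but the least, so its entry rests at minus
    c_x. *)
Lemma signed_perm_arrayE : assigned n = signed_perm_array idem_perm_for.
Proof.
apply/ffunP => x; rewrite !ffunE inE ltn_ord /label idem_perm_ofE.
case: eqVneq => // fix_x; rewrite position_of_fixed // below_class.
by rewrite -idle_beforen //; lia.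
Qed.

Lemma idem_perm_for_corresponds : corresponds iota idem_perm_for.
Proof. by split=> // i; apply: perm_class_enum. Qed.

End Passes.

(* One program for all n; [w n i] is the width in bits of register i on arrays
   of length n, and [up_log 2 n] is the logarithm of n rounded up. *)
Theorem theorem3p21 :
  exists (r : nat) (prog : program r) (w : nat -> 'I_r -> nat) (C : nat),
  forall n : nat, 0 < n ->
    \sum_(i < r) w n i <= up_log 2 n /\
    forall iota : {ffun 'I_n -> 'I_n}, idempotent_fun iota ->
      exists (P : idem_perm n) (t : nat),
        [/\ corresponds iota P,
            t <= C * n &
            computes_in (w n) prog (map_array iota) (signed_perm_array P) t].
Proof.
exists 2, idem_prog, width, 38 => -[//|m] _; split.
  by rewrite big_ord_recl big_ord1 /width /= addn0.
move=> iota iotaK; have [t le_t run_t] := run_passes iotaK.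
exists (idem_perm_for iotaK), t; split=> //.
  exact: idem_perm_for_corresponds.
exists (state 42 ord_max (assigned iota m.+1)); split=> //.
  (* The cleared registers at the start are those of [state] at [ord0]. *)
  rewrite /run -run_t; congr (iter _ _ (Some (Config _ _ _))).
  by apply/ffunP => j; rewrite !ffunE; case: ifP.
exact: signed_perm_arrayE.
Qed.
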